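(* Let $W$ be a complex vector space of dimension $n+1\geq 4$, $\phi:W\to W^*$ an isomorphism such that the quadric $Q(\phi)\subset\mathbb{P}(W)$ has rank $r\ge 3$, $O$ a smooth point of $Q(\phi)$, $T_O$ the hyperplane of $\mathbb{P}(W)$ tangent to $Q(\phi)$ at $O$, and let $\sigma:\mathbb{P}_{n-1}\dashrightarrow\mathbb{P}(W_0)$ be the normal quadratic congruence obtained from $(\phi,O)$ by projection from $O$, $\sigma(Q)=S({}^\bot\eta(Q))$. The following properties are equivalent: 1. $T_O=O^\bot$. 2. $L(\sigma)=H(\sigma)$. 3. The translation $\mathbb{T}(\sigma)$ is linear (i.e. is given by a projective linear automorphism of $\mathbb{P}_{n-1}$).
   Context: Notation. $Q(\phi)$ is the quadric $x.\phi(x)=0$ of $\mathbb{P}(W)$; its rank is that of $\phi_S=\frac12(\phi+{}^t\phi)$. For $X\subset\mathbb{P}(W)$, $X^\bot$ (resp. ${}^\bot X$) is the linear subspace of points $y$ with $x.\phi(y)=0$ (resp. $y.\phi(x)=0$) for all $x\in X$. Points of projective spaces and vectors above them are denoted alike. Construction. Fix a hyperplane $\mathbb{P}_{n-1}=\mathbb{P}(V)$ of $\mathbb{P}(W)$ not containing $O$ and let $\pi:\mathbb{P}(W)\setminus\{O\}\to\mathbb{P}_{n-1}$ be the projection from $O$. $C=\pi(Q(\phi)\cap T_O)$ is a quadric of the hyperplane $\pi(T_O)$ of $\mathbb{P}_{n-1}$. $W_0\subset S^2V^*$ is the $(n+1)$-dimensional space of equations of quadrics of $\mathbb{P}_{n-1}$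 containing $C$. For $Q\in\mathbb{P}_{n-1}\setminus C$, $\eta(Q)$ is the point other than $O$ common to the line $OQ$ and $Q(\phi)$, i.e. $\eta(Q)=(Q.\phi(Q))O-(Q.\phi(O)+O.\phi(Q))Q$. For a hyperplane $\Pi$ of $\mathbb{P}(W)$ with linear equation $h$, $S(\Pi)\in\mathbb{P}(W_0)$ is the quadric ''$\pi(Q(\phi)\cap\Pi)$'', i.e. the quadric of equation $h\circ\eta=0$. The rational map $\sigma:\mathbb{P}_{n-1}\dashrightarrow\mathbb{P}(W_0)$, $Q\mapsto S({}^\bot\eta(Q))$, is a quadratic congruence, i.e. $\sigma^*\mathcal{O}(1)=\mathcal{O}(2)$, $\sigma^*:W_0^*\to S^2V^*$ induces an isomorphism $W_0^*\simeq W_0$, and $P\in\sigma(P)$ whenever $\sigma$ is defined at $P$; it is normal ($W_0$ is the space of all equations of quadrics containing a quadric $C$ of a hyperplane), and induces a birational isomorphism onto $\overline{\sigma(\mathbb{P}_{n-1})}$. For a normal congruence $\sigma$, $H(\sigma)$ denotes the hyperplane containing $C$ (here $H(\sigma)=\pi(T_O)$). The restriction of $\sigma$ to $H(\sigma)$ is constant, and its value is a quadric which is the union of $H(\sigma)$ and another hyperplane $L(\sigma)$ (with $L(\sigma)=H(\sigma)$ if this quadric is a double hyperplane). The translation of $\sigma$ is the birational automorphism $\mathbb{T}(\sigma)=\sigma^{-1}\circ\mathbb{T}(\phi_\sigma)\circ\sigma$ of $\mathbb{P}_{n-1}$, where $\phi_\sigma=(\sigma^* )^{-1}:W_0\to W_0^*$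 and $\mathbb{T}(\phi_\sigma)={}^t\phi_\sigma^{-1}\circ\phi_\sigma\in GL(W_0)$; equivalently $\mathbb{T}(\sigma)(P)=\pi(\mathbb{T}(\phi)(\eta(P)))$ with $\mathbb{T}(\phi)={}^t\phi^{-1}\circ\phi$. *)

(* Defs.v *)
From HB Require Import structures.
From mathcomp Require Import all_boot all_order all_algebra.
From mathcomp Require Import complex.
From mathcomp Require Import boolp classical_sets reals.

Set Implicit Arguments.
Unset Strict Implicit.
Unset Printing Implicit Defensive.

Import GRing.Theory.

Local Open Scope ring_scope.

(* A map [phi : U -> U^*] is identified with a bilinear form: the pairing
   written x.phi(y) is [phi y x]. Points of P(U) are nonzero vectors of U, two
   of which define the same point when they span the same line. *)
Notation bilin K U := 'Hom(U, 'Hom(U, K^o)).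

Section Forms.
Context {K : fieldType}.
Implicit Types U : vectType K.

(* The transpose, U^** being identified with U: x.(trform phi)(y) = y.phi(x). *)
Definition trform U (phi : bilin K U) : bilin K U :=
  linfun (fun x => linfun (fun y => phi y x : K^o)).

Definition symform U (phi : bilin K U) : bilin K U :=
  2^-1 *: (phi + trform phi).

Definition quadric_rank U (phi : bilin K U) : nat := \dim (limg (symform phi)).

Definition translation_form U (phi : bilin K U) : 'End(U) :=
  ((trform phi)^-1 \o phi)%VF.

(* x^bot = {y | x.phi(y) = 0}. *)
Definition rperp U (phi : bilin K U) (x : U) : {vspace U} := lker (trform phi x).

(* [2 *: symform phi x] is the differential at x of x |-> x.phi(x). *)
Definition smooth_point U (phi : bilin K U) (x : U) : Prop :=
  [/\ x != 0, phi x x = 0 & symform phi x != 0].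
Definition tangent U (phi : bilin K U) (x : U) : {vspace U} :=
  lker (symform phi x).

(* Quadratic forms on U (elements of S^2 U^* ) are encoded by their polar
   symmetric bilinear forms B, the value at v being B v v; [polar f] is the
   encoding of the quadratic form f, in characteristic other than 2. *)
Definition polar U (f : U -> K) : bilin K U :=
  linfun (fun x => linfun (fun y => 2^-1 * (f (x + y) - f x - f y) : K^o)).

Definition restr U (A : {vspace U}) (B : bilin K U) : bilin K (subvs_of A) :=
  linfun (fun x => linfun (fun y => B (vsval x) (vsval y) : K^o)).

Inductive polyfun U : (U -> K) -> Prop :=
  | polyfun_const c : polyfun (fun _ => c)
  | polyfun_lin (h : 'Hom(U, K^o)) : polyfun (fun x => h x)
  | polyfun_add f g : polyfun f -> polyfun g -> polyfun (fun x => f x + g x)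
  | polyfun_mul f g : polyfun f -> polyfun g -> polyfun (fun x => f x * g x).

(* P holds on some nonempty (principal) Zariski open subset. *)
Definition generically U (P : U -> Prop) : Prop :=
  exists f : U -> K, [/\ polyfun f, (exists x, f x != 0)
    & forall x, f x != 0 -> P x].

End Forms.

Section Congruence.
Context {K : fieldType} {W : vectType K}.
Implicit Types (phi : bilin K W) (O : W) (V : {vspace W}).

Definition eta phi O (v : W) : W := phi v v *: O - (phi O v + phi v O) *: v.

(* The projection from O onto P(V), for V a complement of the line O. *)
Definition proj_from O V : 'Hom(W, subvs_of V) :=
  (linfun (vsproj V) \o daddv_pi V <[O]>)%VF.

Definition Hsigma phi O V : {vspace subvs_of V} :=
  (proj_from O V @: tangent phi O)%VS.

(* An equation of the quadric C of the hyperplane Hsigma: since O is orthogonal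
   to T_O, the equation of the cone over C in T_O with vertex O is that of
   Q(phi), and Hsigma is the trace of T_O on V. *)
Definition Cform phi O V : bilin K (subvs_of (Hsigma phi O V)) :=
  restr (Hsigma phi O V) (restr V (symform phi)).

(* Containing C is meant scheme-theoretically, i.e. the restriction to Hsigma
   is a multiple of the equation of C: this matters when C is a double
   hyperplane. *)
Definition W0 phi O V : {vspace bilin K (subvs_of V)} :=
  (lker (linfun (fun B : bilin K (subvs_of V) => trform B - B)) :&:
   linfun (restr (Hsigma phi O V)) @^-1: <[Cform phi O V]>)%VS.

(* S maps (the equation h of) a hyperplane of P(W) to the equation of its
   section of Q(phi), projected from O. *)
Definition Sform phi O V (h : 'Hom(W, K^o)) : bilin K (subvs_of V) :=
  polar (fun v : subvs_of V => h (eta phi O (vsval v))).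

(* v |-> S(^bot eta(v)): the hyperplane ^bot x = {y | y.phi(x) = 0} has the
   linear equation [phi x]. *)
Definition sigma phi O V (v : subvs_of V) : subvs_of (W0 phi O V) :=
  vsproj (W0 phi O V) (Sform phi O V (phi (eta phi O (vsval v)))).

(* The map xi |-> xi \o sigma from W0^* to W0. *)
Definition sigma_star phi O V :
    'Hom('Hom(subvs_of (W0 phi O V), K^o), subvs_of (W0 phi O V)) :=
  linfun (fun xi : 'Hom(subvs_of (W0 phi O V), K^o) =>
            vsproj (W0 phi O V) (polar (fun v => xi (sigma phi O v)))).

Definition phi_sigma phi O V : bilin K (subvs_of (W0 phi O V)) :=
  ((sigma_star phi O V)^-1)%VF.

(* The value of sigma on Hsigma, where it is constant, is the union of Hsigma
   and L. *)
Definition is_Lsigma phi O V (L : {vspace subvs_of V}) : Prop :=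
  (\dim L).+1 = \dim V /\
  exists P : subvs_of V, [/\ P \in Hsigma phi O V, sigma phi O P != 0
    & forall v, (vsval (sigma phi O P) v v == 0) =
                (v \in Hsigma phi O V) || (v \in L)].

Definition Lsigma phi O V : {vspace subvs_of V} :=
  xget 0%VS [set L | is_Lsigma phi O L]%classic.

(* P' = (sigma^-1 \o T(phi_sigma) \o sigma)(P): sigma is defined at P, and P' is
   the only point sent by sigma to T(phi_sigma)(sigma(P)). *)
Definition translation_at phi O V (P P' : subvs_of V) : Prop :=
  let Q := translation_form (phi_sigma phi O V) (sigma phi O P) in
  [/\ sigma phi O P != 0, sigma phi O P' != 0,
      <[sigma phi O P']>%VS = <[Q]>%VS
    & forall P'', sigma phi O P'' != 0 -> <[sigma phi O P'']>%VS = <[Q]>%VS ->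
        <[P'']>%VS = <[P']>%VS].

Definition translation_linear phi O V : Prop :=
  exists g : 'End(subvs_of V), lker g = 0%VS /\
    generically (fun P => translation_at phi O P (g P)).

End Congruence.

(* Main.v *)
(* Let b(x, y) = y.phi(x), q(x) = b(x, x), s = b(O, .) + b(., O), so that
   T_O = {s = 0}. All three properties say that T(phi) fixes the point O.
   The map h |-> h \o eta is an isomorphism from W^* to W_0 (rank >= 3 makes q
   nonzero on H), so x |-> S(^bot x) carries phi to phi_sigma and T(phi) to
   T(phi_sigma), and the translation of sigma is
   P |-> pi(T(eta(P))) = q(P) pi(T(O)) - s(P) pi(T(P)).
   On H the congruence takes the value s * b(O, .) up to a scalar, so
   L = {b(O, .) = 0}; T_O = O^bot and L = H both mean that the two linear forms
   b(O, .) and b(., O) are proportional, i.e. that T(O) is proportional to O.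
   In that case the first term of the translation vanishes and pi \o T is the
   required linear map. *)
From HB Require Import structures.
Require Import Defs.
From mathcomp Require Import all_boot all_order all_algebra.
From mathcomp Require Import complex boolp classical_sets reals.
From mathcomp Require Import ring.

Set Implicit Arguments.
Unset Strict Implicit.
Unset Printing Implicit Defensive.

Import GRing.Theory Num.Theory.
Local Open Scope ring_scope.

(** * Linear maps given by functions, bilinear forms and polarisation *)

Lemma linfun_linearE (K : fieldType) (U V : vectType K) (f : U -> V) :
  linear f -> linfun f =1 f.
Proof.
move=> lin_f.
pose F := GRing.isLinear.Build K U V _ f lin_f.
pose fL : {linear U -> V} := HB.pack f F.
exact: (lfunE fL).
Qed.

Lemma linfun_bilinearE (K : fieldType) (U : vectType K) (b : U -> U -> K) :
  (forall x, linear (b x : U -> K^o)) -> (forall y, linear (b^~ y : U -> K^o)) ->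
  forall x y, linfun (fun x => linfun (fun y => b x y : K^o)) x y = b x y.
Proof.
move=> linr linl x y; rewrite linfun_linearE ?linfun_linearE // => a u v.
by apply/lfunP => z; rewrite !lfun_simp !linfun_linearE// linl.
Qed.

Lemma lfun_subZ (K : fieldType) (U V : vectType K) (f : 'Hom(U, V)) a b x y :
  f (a *: x - b *: y) = a *: f x - b *: f y.
Proof. by rewrite linearB !linearZ. Qed.

Section Forms.
Context {K : fieldType} {U : vectType K}.
Implicit Types (B D : bilin K U) (f g : 'Hom(U, K^o)) (x y : U).

Lemma formDl B x y z : B (x + y) z = (B x z + B y z : K).
Proof. by rewrite linearD add_lfunE. Qed.

Lemma formDr B x y z : B x (y + z) = (B x y + B x z : K).
Proof. exact: linearD. Qed.

Lemma formNl B x y : B (- x) y = (- B x y : K).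
Proof. by rewrite linearN opp_lfunE. Qed.

Lemma formNr B x y : B x (- y) = (- B x y : K).
Proof. exact: linearN. Qed.

Lemma formZl B a x y : B (a *: x) y = (a * B x y : K).
Proof. by rewrite linearZ scale_lfunE. Qed.

Lemma formZr B a x y : B x (a *: y) = (a * B x y : K).
Proof. exact: linearZ. Qed.

Lemma form0l B x : B 0 x = 0.
Proof. by rewrite linear0 zero_lfunE. Qed.

Lemma form0r B x : B x 0 = 0.
Proof. exact: linear0. Qed.

Definition form_expand :=
  (formDl, formDr, formNl, formNr, formZl, formZr, form0l, form0r).

Lemma form_addE B D x y : (B + D) x y = (B x y + D x y : K).
Proof. by rewrite !add_lfunE. Qed.

Lemma form_oppE B x y : (- B) x y = (- B x y : K).
Proof. by rewrite !opp_lfunE. Qed.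

Lemma form_scaleE a B x y : (a *: B) x y = (a * B x y : K).
Proof. by rewrite !scale_lfunE. Qed.

Definition form_ops := (form_addE, form_oppE, form_scaleE).

Lemma trformE B x y : trform B x y = B y x.
Proof. by apply: linfun_bilinearE => [z|z] a u v; rewrite /= !form_expand. Qed.

Lemma sym_formC B : trform B = B -> forall x y, B x y = B y x.
Proof. by move=> symB x y; rewrite -{1}symB trformE. Qed.

Lemma trform_linear : linear (@trform K U).
Proof.
move=> a B D; apply/lfunP => x; apply/lfunP => y.
by rewrite trformE 2!form_addE 2!form_scaleE !trformE.
Qed.

Lemma symformE B x y : symform B x y = 2^-1 * (B x y + B y x).
Proof. by rewrite /symform form_scaleE form_addE trformE. Qed.

Lemma restrE (A : {vspace U}) B (x y : subvs_of A) :
  restr A B x y = B (vsval x) (vsval y).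
Proof.
by apply: linfun_bilinearE => [z|z] a u v; rewrite /= !form_expand.
Qed.

Lemma symformC B x y : symform B x y = symform B y x.
Proof. by rewrite !symformE addrC. Qed.

Lemma eq_linfun2 (b c : U -> U -> K) : b =2 c ->
  linfun (fun x => linfun (fun y => b x y : K^o)) =
  linfun (fun x => linfun (fun y => c x y : K^o)).
Proof.
by move=> E; congr linfun; apply/funext => x; congr linfun; apply/funext.
Qed.

(** Polarisation sees only the symmetric part, so [polar] can be computed from any bilinear form
    with the right diagonal, symmetric or not. *)
Lemma polarE B (q : U -> K) : (forall v, q v = B v v) -> polar q = symform B.
Proof.
move=> qE; apply/lfunP => x; apply/lfunP => y.
rewrite /polar (@eq_linfun2 _ (fun u v => symform B u v)).
  by apply: linfun_bilinearE => [z|z] a u v; rewrite /= !form_expand.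
move=> u v; rewrite symformE !qE !form_expand; ring.
Qed.

Lemma form_diag_inj B D : (2 : K) != 0 -> trform B = B -> trform D = D ->
  (forall x, B x x = D x x) -> B = D.
Proof.
move=> nz2 sB sD E; apply/lfunP => x; apply/lfunP => y.
apply: (mulfI nz2); have := E (x + y).
rewrite !form_expand !E (sym_formC sB y x) (sym_formC sD y x).
move: (B x y) (D x y) (D x x) (D y y) => b d dx dy h.
have -> : 2 * b = (dx + b + (b + dy)) - dx - dy by ring.
by rewrite h; ring.
Qed.

Lemma lker_form_sub f g : (lker f <= lker g)%VS -> exists c, g = c *: f.
Proof.
move=> /subvP fg; have [f0|] := eqVneq f 0.
  exists 0; rewrite f0 scale0r; apply/lfunP=> x; apply/eqP.
  by rewrite zero_lfunE -memv_ker fg // f0 memv_ker zero_lfunE.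
case/lfunPn => v; rewrite zero_lfunE => fv.
exists (g v / f v); apply/lfunP => x; apply/eqP; rewrite -subr_eq0.
(* Subtracting the right multiple of [v] brings [x] into the kernel of [f], hence into that of
   [g]. *)
have /fg : x - (f x / f v) *: v \in lker f.
  by rewrite memv_ker linearB linearZ /= -[_ *: _]/(_ * _) divfK// subrr.
rewrite memv_ker linearB linearZ /= scale_lfunE => /eqP <-; apply/eqP.
rewrite -![_ *: _]/(_ * _); ring.
Qed.

Lemma form_sep x : (forall f, f x = 0) -> x = 0.
Proof.
move=> h; rewrite (coord_vbasis (memvf x)) big1// => i _.
have := h (linfun (coord (vbasis fullv) i : U -> K^o)).
rewrite linfun_linearE => [->|a u v]; last by rewrite linearP.
by rewrite scale0r.
Qed.

Lemma form_sep_neq0 x : x != 0 -> exists f, f x = 1.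
Proof.
move=> x0; have [f fx] : exists f, f x != 0.
  apply: contrapT => h; move/eqP: x0; apply; apply: form_sep => f.
  by apply/eqP; apply/negPn/negP => fx; apply: h; exists f.
by exists ((f x)^-1 *: f); rewrite scale_lfunE; apply: mulVf.
Qed.

Lemma dim_dual : \dim {:'Hom(U, K^o)} = \dim {:U}.
Proof. by rewrite !dimvf; apply: muln1. Qed.
End Forms.

(** * Nondegenerate forms, their translation, and unions of hyperplanes *)

Lemma restr_linear (K : fieldType) (U : vectType K) (A : {vspace U}) :
  linear (@restr K U A).
Proof.
move=> a B D; apply/lfunP => x; apply/lfunP => y.
by rewrite restrE 2!form_addE 2!form_scaleE !restrE.
Qed.

Lemma lker0_limg_full (K : fieldType) (U V : vectType K) (f : 'Hom(U, V)) :
  \dim {:U} = \dim {:V} -> lker f = 0%VS -> limg f = fullv.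
Proof.
move=> dUV kf; apply/eqP; rewrite eqEdim subvf -dUV /=.
by rewrite limg_dim_eq ?kf ?capv0.
Qed.

Lemma lker0_lfunVK_dim (K : fieldType) (U V : vectType K) (f : 'Hom(U, V)) :
  \dim {:U} = \dim {:V} -> lker f = 0%VS -> cancel f^-1%VF f.
Proof.
by move=> dUV kf y; apply: limg_lfunVK; rewrite lker0_limg_full ?memvf.
Qed.

Lemma lker_eq0 (K : fieldType) (U V : vectType K) (f : 'Hom(U, V)) :
  (forall x, f x = 0 -> x = 0) -> lker f = 0%VS.
Proof.
move=> h; apply/eqP; rewrite -subv0; apply/subvP => x.
by rewrite memv_ker memv0 => /eqP/h ->.
Qed.

Lemma form_nondegr (K : fieldType) (U : vectType K) (B : bilin K U) x :
  limg B = fullv -> (forall y, B y x = 0) -> x = 0.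
Proof.
move=> Bf h; apply: form_sep => f.
have /memv_imgP[y _ ->] : f \in limg B by rewrite Bf memvf.
exact: h.
Qed.

Lemma lker_trform (K : fieldType) (U : vectType K) (B : bilin K U) :
  limg B = fullv -> lker (trform B) = 0%VS.
Proof.
move=> Bf; apply: lker_eq0 => x h; apply: (form_nondegr Bf) => y.
by rewrite -trformE h zero_lfunE.
Qed.

(** Surjectivity of [B] makes its transpose injective, hence invertible by equality of dimensions.
    Apart from linearity, this adjunction rule is all that is used of T below. *)
Lemma translation_formE (K : fieldType) (U : vectType K) (B : bilin K U) x y :
  limg B = fullv -> B y (translation_form B x) = B x y.
Proof.
move=> Bf; rewrite -trformE /translation_form comp_lfunE /=.
by rewrite lker0_lfunVK_dim ?dim_dual ?lker_trform.
Qed.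

Lemma dim_lker_form (K : fieldType) (U : vectType K) (f : 'Hom(U, K^o)) :
  f != 0 -> (\dim (lker f)).+1 = \dim {:U}.
Proof.
case/lfunPn => x; rewrite zero_lfunE => fx.
rewrite -(limg_ker_dim f fullv) capfv -addn1; congr addn; apply/eqP.
rewrite eqn_leq; apply/andP; split.
  have := dimvS (memv_img f (memvf x)); rewrite dim_vline fx; exact.
by apply: leq_trans (dimvS (subvf _)) _; rewrite dimvf.
Qed.

Lemma subv_union (K : fieldType) (U : vectType K) (A B C : {vspace U}) :
  (forall x, x \in C -> (x \in A) || (x \in B)) -> (C <= A)%VS \/ (C <= B)%VS.
Proof.
move=> h; have [CA|/subvPn[x xC xA]] := boolP (C <= A)%VS; first by left.
right; apply/subvP => y yC; have := h _ xC; rewrite (negPf xA) /= => xB.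
case/orP: (h _ yC) => // yA; case/orP: (h _ (memvD xC yC)) => xy.
  by case/negP: xA; rewrite -(addrK y x) memvB.
by rewrite -(addKr x y) memvD // memvN.
Qed.

(** A subspace covered by two subspaces lies in one of them. If [C] falls into [A], the same
    argument applied to [B] puts it in [A = C]: this is the double hyperplane. *)
Lemma hyperplane_union_inj (K : fieldType) (U : vectType K)
    (A B C : {vspace U}) : \dim A = \dim B -> \dim C = \dim B ->
  (forall x, (x \in A) || (x \in B) = (x \in A) || (x \in C)) -> C = B.
Proof.
have eqv (X Y : {vspace U}) : \dim X = \dim Y -> (X <= Y)%VS -> X = Y.
  by move=> d XY; apply/eqP; rewrite eqEdim XY d /=.
move=> dA dC h; have [|CA|] := @subv_union _ _ A B C; last exact: eqv.
  by move=> x xC; rewrite h xC orbT.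
have {}CA : C = A by apply: eqv; rewrite ?dA.
have [|BA|BC] := @subv_union _ _ A C B.
- by move=> x xB; rewrite -h xB orbT.
- by rewrite CA; apply/esym/eqv.
- by apply/esym/eqv.
Qed.

(** * Polynomial functions and Zariski density *)

Section Polyfun.
Context {K : fieldType} {U : vectType K}.
Implicit Types (f g : U -> K) (B : bilin K U).
Hypothesis char0 : [pchar K] =i pred0.

Lemma poly_char0_eq0 (q : {poly K}) : (forall n, q.[n%:R] = 0) -> q = 0.
Proof.
move=> q0; apply/eqP/negPn/negP => qn0.
have natr_inj : injective (fun i => i%:R : K).
  suff le i j : (i <= j)%N -> i%:R = j%:R :> K -> i = j.
    by move=> i j E; have [/le->|/ltnW/le/(_ (esym E))->] := leqP i j.
  move=> ij E; apply/eqP; rewrite eqn_leq ij /= -subn_eq0.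
  by rewrite -(pcharf0P K).1 // natrB // E subrr.
(* In characteristic 0 the first [size q] natural numbers are distinct roots, one more than the
   degree allows. *)
have /(max_poly_roots qn0) : all (root q) [seq i%:R | i <- iota 0 (size q)].
  by apply/allP => _ /mapP[i _ ->]; rewrite rootE q0.
rewrite map_inj_uniq // iota_uniq size_map size_iota ltnn.
by move/(_ isT).
Qed.

Lemma polyfun_line f x v : polyfun f ->
  exists q : {poly K}, forall t, f (x + t *: v) = q.[t].
Proof.
elim=> [c|h|g1 g2 _ [q1 h1] _ [q2 h2]|g1 g2 _ [q1 h1] _ [q2 h2]].
- by exists c%:P => t; rewrite hornerC.
- by exists ((h x)%:P + (h v) *: 'X) => t; rewrite !hornerE linearD linearZ mulrC.
- by exists (q1 + q2) => t; rewrite hornerD h1 h2.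
- by exists (q1 * q2) => t; rewrite hornerM h1 h2.
Qed.

(** On the line from [x] to a point where [f] is nonzero, [f] and [g] become polynomials in one
    variable whose product vanishes at every natural number. The first factor is nonzero at 1, so
    the second is zero, in particular at 0, the parameter of [x]. *)
Lemma polyfun_dense f g : polyfun f -> polyfun g -> (exists x, f x != 0) ->
  (forall x, f x != 0 -> g x = 0) -> forall x, g x = 0.
Proof.
move=> pf pg [x0 fx0] fg x.
have [q qE] := polyfun_line x (x0 - x) pf.
have [r rE] := polyfun_line x (x0 - x) pg.
have : q * r = 0.
  apply: poly_char0_eq0 => n; rewrite hornerM -qE -rE; set y := x + _.
  by have [->|/fg ->] := eqVneq (f y) 0; rewrite ?mul0r ?mulr0.
move/eqP; rewrite mulf_eq0 => /orP[] /eqP z.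
  by move: fx0; rewrite -[x0](subrKC x) -[_ - x]scale1r qE z horner0 eqxx.
by have := rE 0; rewrite scale0r addr0 z horner0.
Qed.

Lemma polyfun_sum (I : Type) (r : seq I) (F : I -> U -> K) :
  (forall i, polyfun (F i)) -> polyfun (fun x => \sum_(i <- r) F i x).
Proof.
move=> pF; elim: r => [|i r IHr].
  by under eq_fun do rewrite big_nil; apply: polyfun_const.
by under eq_fun do rewrite big_cons; apply: polyfun_add.
Qed.

Lemma polyfun_diag B : polyfun (fun x => B x x).
Proof.
pose e := vbasis (@fullv K U).
have -> : (fun x => B x x) = (fun x => \sum_i coord e i x * B e`_i x).
  apply/funext => x; rewrite {1}(coord_vbasis (memvf x)) linear_sum sum_lfunE.
  by apply: eq_bigr => i _; rewrite linearZ scale_lfunE.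
apply: polyfun_sum => i; apply: polyfun_mul; last exact: polyfun_lin.
have -> : coord e i = (linfun (coord e i : U -> K^o) : U -> K).
  by apply/funext => x; rewrite linfun_linearE // => a u v; rewrite linearP.
exact: polyfun_lin.
Qed.
End Polyfun.

(** * Projection from O and the hyperplane H *)

Section Congruence.
Context {K : fieldType} {W : vectType K} (phi : bilin K W) (O : W)
  (V : {vspace W}).
Hypotheses (nz2 : (2 : K) != 0) (phi_inj : lker phi = 0%VS)
  (phi_full : limg phi = fullv) (O_smooth : smooth_point phi O)
  (dimV : (\dim V).+1 = \dim {:W}) (OV : O \notin V).

Notation s x := ((phi O x : K) + (phi x O : K)).
Notation p := (proj_from O V).
Notation H := (Hsigma phi O V).
Notation T := (translation_form phi).
Notation W0 := (W0 phi O V).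
Notation Sform := (Sform phi O V).

Lemma O_neq0 : O != 0. Proof. by case: O_smooth. Qed.

Lemma phiOO : phi O O = 0. Proof. by case: O_smooth. Qed.

Lemma halfD (a : K) : 2^-1 * (a + a) = a.
Proof. by rewrite -[a + a]/(a *+ 2) -[a *+ 2]mulr_natl mulKf. Qed.

Lemma symform2 x y : 2 * symform phi x y = phi x y + phi y x.
Proof. by rewrite symformE mulrA mulfV // mul1r. Qed.

Lemma cap_line : (V :&: <[O]> = 0)%VS.
Proof.
apply/eqP; rewrite -subv0; apply/subvP => x /[!memv_cap] /andP[xV /vlineP[c xE]].
move: xV; rewrite xE; have [->|c0] := eqVneq c 0; first by rewrite scale0r !mem0v.
by move/(memvZ c^-1); rewrite scalerA mulVf // scale1r (negPf OV).
Qed.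

Lemma proj_id (v : subvs_of V) : p (vsval v) = v.
Proof.
by rewrite comp_lfunE /= lfunE /= daddv_pi_id ?cap_line ?subvsP // vsvalK.
Qed.

Lemma proj_decomp w : exists c, w = vsval (p w) + c *: O.
Proof.
have wVO : w \in (V + <[O]>)%VS.
  suff -> : (V + <[O]>)%VS = fullv by apply: memvf.
  apply/eqP; rewrite eqEdim subvf dimv_disjoint_sum ?cap_line //.
  by rewrite dim_vline O_neq0 addn1 dimV /=.
have /vlineP[c cE] := memv_pi <[O]> V w; exists c.
rewrite -cE -{1}(daddv_pi_add cap_line wVO); congr (_ + _).
by rewrite comp_lfunE /= lfunE /= vsprojK // memv_pi.
Qed.

Lemma projO : p O = 0.
Proof.
have [c OE] := proj_decomp O.
have : (1 - c) *: O \in V by rewrite scalerBl scale1r {1}OE addrK subvsP.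
have [/eqP|c1] := eqVneq (1 - c) 0.
  rewrite subr_eq0 => /eqP c1 _; apply: subvs_inj; apply: (addIr (c *: O)).
  by rewrite -OE linear0 add0r -c1 scale1r.
by move/(memvZ (1 - c)^-1); rewrite scalerA mulVf // scale1r (negPf OV).
Qed.

Lemma mem_tangent w : (w \in tangent phi O) = (s w == 0).
Proof.
by rewrite /tangent memv_ker symformE mulf_eq0 invr_eq0 (negPf nz2).
Qed.

(** Since s vanishes at O, a vector lies in T_O exactly when its projection does. *)
Lemma mem_Hsigma (v : subvs_of V) : (v \in H) = (s (vsval v) == 0).
Proof.
rewrite -mem_tangent; apply/memv_imgP/idP => [[w wT ->]|vT]; last first.
  by exists (vsval v); rewrite ?proj_id.
move: wT; have [c {1}->] := proj_decomp w.
by rewrite !mem_tangent !form_expand phiOO mulr0 !addr0.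
Qed.

Lemma exists_sV : exists v : subvs_of V, s (vsval v) = 1.
Proof.
case: O_smooth => _ _ /lfunPn[w]; rewrite zero_lfunE => sw.
have {sw} : s w != 0 by rewrite -mem_tangent memv_ker.
have [c {1 2}->] := proj_decomp w.
rewrite !form_expand phiOO mulr0 !addr0 => sw.
exists ((s (vsval (p w)))^-1 *: p w).
by rewrite linearZ /= !form_expand -mulrDr mulVf.
Qed.

(** * The isomorphism from linear forms on W to W_0 *)

Let sect_form (h : 'Hom(W, K^o)) : bilin K (subvs_of V) :=
  linfun (fun x => linfun (fun y : subvs_of V =>
    h O * phi (vsval x) (vsval y) - s (vsval x) * h (vsval y) : K^o)).

Lemma sect_formE h x y : sect_form h x y =
  h O * phi (vsval x) (vsval y) - s (vsval x) * h (vsval y).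
Proof.
apply: linfun_bilinearE => [z|z] a u v; rewrite /= !form_expand ?linearP /=.
  rewrite -![_ *: _]/(_ * _); ring.
rewrite -![_ *: _]/(_ * _); ring.
Qed.

Lemma eta_formE (h : 'Hom(W, K^o)) v :
  h (eta phi O v) = phi v v * h O - s v * h v.
Proof. by rewrite linearB !linearZ. Qed.

Lemma SformE h x y : Sform h x y =
  h O * symform phi (vsval x) (vsval y)
  - 2^-1 * (s (vsval x) * h (vsval y) + s (vsval y) * h (vsval x)).
Proof.
rewrite /Sform (@polarE _ _ (sect_form h)); last first.
  by move=> v; rewrite eta_formE sect_formE mulrC.
rewrite !symformE !sect_formE; ring.
Qed.

Lemma Sform_diag h v : Sform h v v = h (eta phi O (vsval v)).
Proof.
by rewrite SformE eta_formE symformE !halfD mulrC.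
Qed.

Lemma Sform_linear : linear Sform.
Proof.
move=> a h k; apply/lfunP => x; apply/lfunP => y.
rewrite !form_ops !SformE !add_lfunE !scale_lfunE.
rewrite -![_ *: _]/(_ * _); ring.
Qed.

Lemma mem_W0 B : reflect
  (trform B = B /\ exists c, restr H B = c *: Cform phi O V) (B \in W0).
Proof.
rewrite memv_cap memv_ker -memv_preim !linfun_linearE; first last.
- by move=> a B1 B2; rewrite trform_linear scalerBr opprD addrACA.
- exact: restr_linear.
rewrite subr_eq0; apply: (iffP andP) => [[/eqP ? /vlineP]|[/eqP ? /vlineP]] //.
Qed.

Lemma Sform_W0 h : Sform h \in W0.
Proof.
apply/mem_W0; split.
  apply/lfunP => x; apply/lfunP => y; rewrite trformE !SformE symformE.
  rewrite [in RHS]symformE; ring.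
exists (h O); apply/lfunP => x; apply/lfunP => y.
rewrite restrE form_scaleE /Cform restrE [in RHS]restrE SformE.
have /eqP-> : s (vsval (vsval x)) == 0 by rewrite -mem_Hsigma subvsP.
have /eqP-> : s (vsval (vsval y)) == 0 by rewrite -mem_Hsigma subvsP.
by rewrite !mul0r addr0 mulr0 subr0.
Qed.

(** On H, [B] is c times the quadric, so D = B - c phi_S vanishes there. Evaluating D at x - s(x)
    v0, which is in H, gives D(x, x) = - s(x) k(x) with [k] linear. The preimage is the form equal
    to [k] on V and to [c] at O. *)
Lemma Sform_surj (B : bilin K (subvs_of V)) : B \in W0 -> exists h, Sform h = B.
Proof.
move=> BW0; have [symB [c cE]] := elimT (mem_W0 B) BW0; have [v0 sv0] := exists_sV.
have BC := sym_formC symB.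
have BH x y : x \in H -> y \in H ->
    B x y = c * symform phi (vsval x) (vsval y).
  move=> xH yH; have := congr1 (fun F : bilin K _ => F (vsproj H x) (vsproj H y)) cE.
  by rewrite /= form_scaleE /Cform !restrE !vsprojK.
have [l lO] := form_sep_neq0 O_neq0.
pose D := B - c *: restr V (symform phi).
have DE x y : D x y = B x y - c * symform phi (vsval x) (vsval y).
  by rewrite /D form_addE form_oppE [(_ *: restr _ _) _ _]form_scaleE restrE.
pose k : 'Hom(subvs_of V, K^o) :=
  linfun (fun x => D v0 v0 * s (vsval x) - 2 * D v0 x : K^o).
have kE x : k x = D v0 v0 * s (vsval x) - 2 * D v0 x.
  apply: linfun_linearE => a u v /=; rewrite !form_expand linearP /=.
  rewrite -![_ *: _]/(_ * _); ring.
(* As [l] takes the value 1 at O, the difference of its two values is the coefficient of O in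
   [w]. *)
pose h : 'Hom(W, K^o) :=
  linfun (fun w => k (p w) + c * (l w - l (vsval (p w))) : K^o).
have hE w : h w = k (p w) + c * (l w - l (vsval (p w))).
  apply: linfun_linearE => a u v; rewrite /= !linearP /=.
  rewrite -![_ *: _]/(_ * _); ring.
have hO : h O = c.
  by rewrite hE projO -[vsval 0]/(0 : W) !linear0 lO addr0 add0r mulr1.
have hV v : h (vsval v) = k v by rewrite hE proj_id subrr mulr0 addr0.
exists h; apply: form_diag_inj => // [|x].
  by have [] := elimT (mem_W0 _) (Sform_W0 h).
pose t : K := s (vsval x).
have vE : vsval (x - t *: v0) = vsval x - t *: vsval v0 by [].
have xH : x - t *: v0 \in H.
  rewrite mem_Hsigma vE !form_expand addrACA -opprD -mulrDr sv0 mulr1.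
  by rewrite subrr.
have := BH _ _ xH xH.
rewrite SformE hO hV halfD kE !DE vE -[s (vsval x)]/t !form_expand.
rewrite (BC x v0) (symformC _ (vsval x) (vsval v0)).
move: (B x x) (B v0 x) (B v0 v0) (symform phi _ _) (symform phi _ _) (symform phi _ _).
move=> a b d e f g BE.
(* The right side is rearranged to exhibit the expansion of B at x - t v0, which [BE] evaluates. *)
rewrite [RHS](_ : a = a - t * b + (- (t * b) - - (t * (t * d)))
  + 2 * t * b - t * t * d); last by ring.
by rewrite BE; ring.
Qed.

(** The vanishing of q(v) h(O) - s(v) h(v) gives h(O) = 0 at [P0], then h(v) = 0 off H. The
    complement of H spans V, so [h] is zero on V and at O. *)
Lemma Sform_inj (P0 : subvs_of V) (h : 'Hom(W, K^o)) :
  P0 \in H -> phi (vsval P0) (vsval P0) != 0 ->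
  Sform h = 0 -> h = 0.
Proof.
move=> P0H qP0 S0.
have h_eta (v : subvs_of V) : h (eta phi O (vsval v)) = 0 
  by have := Sform_diag h v; rewrite S0 !zero_lfunE.
have hO : h O = 0.
  have := h_eta P0; rewrite eta_formE.
  move: P0H; rewrite mem_Hsigma => /eqP ->.
  by rewrite mul0r subr0 => /eqP; rewrite mulf_eq0 (negPf qP0) => /eqP.
have hs (v : subvs_of V) : s (vsval v) != 0 -> h (vsval v) = 0.
  move=> sv; have /eqP := h_eta v; rewrite eta_formE hO mulr0 sub0r oppr_eq0.
  by rewrite mulf_eq0 (negPf sv) => /eqP.
have [v0 sv0] := exists_sV.
have h0 (v : subvs_of V) : h (vsval v) = 0.
  have [sv|] := eqVneq (s (vsval v)) 0; last exact: hs.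
  have h2 : h (vsval v0) = 0 by rewrite hs // sv0 oner_neq0.
  have vE : vsval (v + v0) = vsval v + vsval v0 by [].
  have : h (vsval (v + v0)) = 0.
    by rewrite hs // vE !form_expand addrACA sv sv0 add0r oner_neq0.
  by rewrite vE linearD /= h2 addr0.
apply/lfunP => w; have [c ->] := proj_decomp w.
by rewrite linearD linearZ /= hO h0 scaler0 addr0 zero_lfunE.
Qed.


(* If q vanished on H it would vanish on T_O = H + O, and then every phi_S(x)
   would lie in the span of phi_S(O) and of one further form. *)
Lemma exists_nonisotropic : (3 <= quadric_rank phi)%N ->
  exists2 P, P \in H & phi (vsval P) (vsval P) != 0.
Proof.
move=> rk; apply: contrapT => noP.
have qH P : P \in H -> phi (vsval P) (vsval P) = 0.
  by move=> PH; apply/eqP/negPn/negP => qP; apply: noP; exists P.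
have symH P Q : P \in H -> Q \in H -> symform phi (vsval P) (vsval Q) = 0.
  move=> PH QH; apply: (mulfI nz2); rewrite symform2 mulr0.
  have := qH _ (memvD PH QH); rewrite -[vsval (P + Q)]/(vsval P + vsval Q).
  by rewrite !form_expand !qH // add0r addr0 addrC.
have [v0 sv0] := exists_sV.
pose w0 := vsval v0.
have decomp w : exists h, exists2 c, h \in H & w = vsval h + s w *: w0 + c *: O.
  have [c wE] := proj_decomp w; exists (p w - s w *: v0); exists c.
    rewrite mem_Hsigma -[vsval _]/(vsval (p w) - s w *: w0) !form_expand.
    rewrite addrACA -opprD -mulrDr sv0 mulr1 subr_eq0 {3 4}wE !form_expand.
    by rewrite phiOO mulr0 !addr0.
  by rewrite -[vsval _]/(vsval (p w) - s w *: w0) subrK.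
suff : (limg (symform phi) <= <[symform phi O]> + <[symform phi w0]>)%VS.
  move/dimvS => le; have := leq_trans rk le; rewrite ltnNge => /negP; apply.
  apply: leq_trans (dimv_add_leqif _ _) _.
  by rewrite !dim_vline (leq_add (leq_b1 _) (leq_b1 _)).
apply/subvP => _ /memv_imgP[w _ ->].
have [h [c hH {1}->]] := decomp w.
(* This form kills H and O, so it is a multiple of s; the factor 2 appears because phi_S(O) is
   s/2. *)
have hE : symform phi (vsval h) = (2 * symform phi (vsval h) w0) *: symform phi O.
  apply/lfunP => u; rewrite [RHS]scale_lfunE -[RHS]/(_ * _) mulrAC symform2.
  have [h' [c' hH' {1}->]] := decomp u.
  rewrite !form_expand symH // add0r [X in _ + c' * X](_ : _ = 0) ?mulr0 ?addr0 //.
  by apply: (mulfI nz2); rewrite symform2 mulr0 addrC; apply/eqP; rewrite -mem_Hsigma.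
by rewrite !linearD !linearZ /= hE addrAC -scalerDl memv_add // memvZ // memv_line.
Qed.

(** * Transport of phi and T(phi) to W_0 *)

Context (P0 : subvs_of V).
Hypotheses (P0H : P0 \in H) (qP0 : phi (vsval P0) (vsval P0) != 0).

Let S : 'Hom('Hom(W, K^o), subvs_of W0) :=
  linfun (fun h => vsproj W0 (Sform h)).

Lemma S_val h : S h = vsproj W0 (Sform h).
Proof. by apply: linfun_linearE => a u v; rewrite Sform_linear linearP. Qed.

Lemma vsval_S h : vsval (S h) = Sform h.
Proof. by rewrite S_val vsprojK // Sform_W0. Qed.

Lemma S_inj h : S h = 0 -> h = 0.
Proof.
move=> Sh; apply: (Sform_inj P0H qP0).
by rewrite -vsval_S Sh.
Qed.

Lemma S_surj B : exists h, S h = B.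
Proof.
have [h hB] := Sform_surj (subvsP B).
by exists h; apply: subvs_inj; rewrite vsval_S.
Qed.

(* [sigma_form x] is the equation of the quadric S(^bot x). *)
Let sigma_form : 'Hom(W, subvs_of W0) := (S \o phi)%VF.

Lemma sigma_form_inj x : sigma_form x = 0 -> x = 0.
Proof.
rewrite /sigma_form comp_lfunE => /S_inj/eqP; rewrite -memv_ker phi_inj memv0.
by move/eqP.
Qed.

Lemma sigma_form_surj B : exists x, sigma_form x = B.
Proof.
have [h <-] := S_surj B.
have /memv_imgP[x _ ->] : h \in limg phi by rewrite phi_full memvf.
by exists x; rewrite /sigma_form comp_lfunE.
Qed.

Lemma sigma_eta v : sigma phi O v = sigma_form (eta phi O (vsval v)).
Proof. by rewrite /sigma_form comp_lfunE S_val. Qed.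

(** Since sigma is [sigma_form] after eta, composing [xi] with it gives h(eta) for the pulled-back
    form h. Thus sigma^* is the transpose of [sigma_form] followed by [S]. *)
Lemma sigma_starE xi : sigma_star phi O V xi = S (xi \o sigma_form)%VF.
Proof.
have E (x : 'Hom(subvs_of W0, K^o)) :
  vsproj W0 (polar (fun v => x (sigma phi O v))) = S (x \o sigma_form)%VF.
  rewrite S_val; congr (vsproj _ (polar _)); apply/funext => v.
  by rewrite sigma_eta comp_lfunE.
rewrite -E; apply: linfun_linearE => a u v; rewrite !E -linearP.
by rewrite comp_lfunDl comp_lfunZl.
Qed.

Let dimW0 : \dim {:'Hom(subvs_of W0, K^o)} = \dim {:subvs_of W0}.
Proof. exact: dim_dual. Qed.

Lemma lker_sigma_star : lker (sigma_star phi O V) = 0%VS.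
Proof.
apply: lker_eq0 => xi; rewrite sigma_starE => /S_inj xi0; apply/lfunP => B.
have [x <-] := sigma_form_surj B.
by rewrite -comp_lfunE xi0 !zero_lfunE.
Qed.

(** Applying sigma^* to [phi_sigma (sigma_form x)] gives back [sigma_form x], that is [S (phi x)];
    cancelling the injective [S] leaves an equality of forms on W. *)
Lemma phi_sigmaE x y : phi_sigma phi O V (sigma_form x) (sigma_form y) = phi x y.
Proof.
have := lker0_lfunVK_dim dimW0 lker_sigma_star (sigma_form x).
rewrite sigma_starE {3}/sigma_form comp_lfunE => /eqP; rewrite -subr_eq0 -linearB.
move/eqP/S_inj/eqP; rewrite subr_eq0 => /eqP/(congr1 (fun f : 'Hom(W, K^o) => f y)).
by rewrite comp_lfunE.
Qed.

Lemma phi_sigma_full : limg (phi_sigma phi O V) = fullv.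
Proof.
apply: lker0_limg_full; first by rewrite dimW0.
apply: lker_eq0 => B; have [x <-] := sigma_form_surj B => xi0.
suff /eqP : phi x = 0 by rewrite -memv_ker phi_inj memv0 => /eqP ->; rewrite linear0.
by apply/lfunP => y; rewrite -phi_sigmaE xi0 !zero_lfunE.
Qed.

Lemma translation_sigmaE x :
  translation_form (phi_sigma phi O V) (sigma_form x) = sigma_form (T x).
Proof.
apply/eqP; rewrite -subr_eq0; apply/eqP.
apply: (form_nondegr phi_sigma_full) => B; have [y <-] := sigma_form_surj B.
rewrite !form_expand (translation_formE _ _ phi_sigma_full) !phi_sigmaE.
by rewrite translation_formE // subrr.
Qed.

Lemma lker_sigma_form : lker sigma_form == 0%VS.
Proof. by apply/eqP/lker_eq0/sigma_form_inj. Qed.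

(** Pulling everything back along the injective [sigma_form] lets the translation be studied on
    Q(phi) itself. *)
Lemma translation_atP (P P' : subvs_of V) : translation_at phi O P P' <->
  [/\ eta phi O (vsval P) != 0, eta phi O (vsval P') != 0,
     <[eta phi O (vsval P')]>%VS = <[T (eta phi O (vsval P))]>%VS
   & forall P'', eta phi O (vsval P'') != 0 ->
       <[eta phi O (vsval P'')]>%VS = <[T (eta phi O (vsval P))]>%VS ->
       <[P'']>%VS = <[P']>%VS].
Proof.
have N0 x : (sigma_form x == 0) = (x == 0).
  by rewrite -memv_ker (eqP lker_sigma_form) memv0.
have Nl x y : (<[sigma_form x]> = <[sigma_form y]>)%VS = (<[x]> = <[y]>)%VS.
  apply: propext; rewrite -!limg_line; split=> [/eqP|->] //.
  by rewrite (eq_limg_ker0 _ _ lker_sigma_form) => /eqP.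
rewrite /translation_at !sigma_eta translation_sigmaE !N0 Nl.
by split=> -[? ? ? u]; split=> // P''; have := u P''; rewrite sigma_eta N0 Nl.
Qed.

(* By [translation_formE], this says that O is a fixed point of T(phi). *)
Definition O_eigen := exists l : K, forall y, phi O y = l * phi y O.

(** * The forms cutting out H and L, and the first two conditions *)

Let sV : 'Hom(subvs_of V, K^o) :=
  ((phi O + trform phi O) \o linfun vsval)%VF.

Lemma sVE v : sV v = s (vsval v).
Proof. by rewrite comp_lfunE [linfun _ v]lfunE add_lfunE trformE. Qed.

Lemma sV_neq0 : sV != 0.
Proof.
have [v sv] := exists_sV; apply/lfunPn; exists v.
by rewrite sVE sv zero_lfunE oner_neq0.
Qed.

Lemma Hsigma_lker : H = lker sV.
Proof. by apply/vspaceP => v; rewrite mem_Hsigma memv_ker sVE. Qed.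

Let phiOV : 'Hom(subvs_of V, K^o) := (phi O \o linfun vsval)%VF.

Lemma phiOVE v : phiOV v = phi O (vsval v).
Proof. by rewrite comp_lfunE lfunE. Qed.

Lemma phiO_neq0 : phi O != 0.
Proof. by rewrite -memv_ker phi_inj memv0 O_neq0. Qed.

Lemma trphiO_neq0 : ~ (forall y, phi y O = 0).
Proof. by move/(form_nondegr phi_full)/eqP; rewrite (negPf O_neq0). Qed.

Lemma phiOV_neq0 : phiOV != 0.
Proof.
have /lfunPn[w] := phiO_neq0; rewrite zero_lfunE.
have [c ->] := proj_decomp w; rewrite !form_expand phiOO mulr0 addr0 => h.
by apply/lfunPn; exists (p w); rewrite phiOVE zero_lfunE.
Qed.

Lemma dim_subvsV : \dim {:subvs_of V} = \dim V.
Proof. by rewrite dimvf. Qed.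

Lemma eta_Hsigma P : P \in H ->
  eta phi O (vsval P) = phi (vsval P) (vsval P) *: O.
Proof. by rewrite mem_Hsigma /eta => /eqP ->; rewrite scale0r subr0. Qed.

Lemma sigma_Hsigma P v : P \in H -> vsval (sigma phi O P) v v =
  - (phi (vsval P) (vsval P) * (sV v * phiOV v)).
Proof.
move=> PH; rewrite sigma_eta /sigma_form comp_lfunE vsval_S Sform_diag eta_formE.
rewrite eta_Hsigma // !form_expand phiOO !mulr0 sub0r sVE phiOVE.
by rewrite mulrCA.
Qed.

(** [P0] supplies a point of H where sigma is defined, so the choice made by [xget] is not the
    default 0; it is unique because a hyperplane is determined by its union with H. *)
Lemma LsigmaE : Lsigma phi O V = lker phiOV.
Proof.
have dL := dim_lker_form phiOV_neq0; have dH := dim_lker_form sV_neq0.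
have unionE (P : subvs_of V) : P \in H -> phi (vsval P) (vsval P) != 0 ->
    forall v, (vsval (sigma phi O P) v v == 0) = (v \in H) || (v \in lker phiOV).
  move=> PH qP v; rewrite sigma_Hsigma // oppr_eq0 !mulf_eq0 (negPf qP) /=.
  by rewrite Hsigma_lker !memv_ker.
have sigma0 (P : subvs_of V) : P \in H ->
    (sigma phi O P != 0) = (phi (vsval P) (vsval P) != 0).
  move=> PH; rewrite sigma_eta eta_Hsigma // -memv_ker (eqP lker_sigma_form) memv0.
  by rewrite scaler_eq0 (negPf O_neq0) orbF.
apply: xget_unique => [|L [dL' [P [PH sP E]]]].
  split; first by rewrite dL dim_subvsV.
  by exists P0; split => //; [rewrite sigma0 | apply: unionE].
apply: (@hyperplane_union_inj _ _ H).
- by rewrite Hsigma_lker; apply: succn_inj; rewrite dL dH.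
- by apply: succn_inj; rewrite dL dL' dim_subvsV.
- by move=> v; rewrite -E unionE // -sigma0.
Qed.

Lemma tangent_eq_rperp : tangent phi O = rperp phi O <-> O_eigen.
Proof.
split=> [TE|[l lE]]; last first.
  apply/vspaceP => y; rewrite mem_tangent memv_ker trformE lE.
  rewrite -[X in _ + X]mul1r -mulrDl mulf_eq0.
  have [l1|//] := eqVneq (l + 1) 0.
  have [v] := exists_sV; rewrite lE -[X in _ + X]mul1r -mulrDl l1 mul0r.
  by move/esym/eqP; rewrite (negPf (oner_neq0 _)).
have [|c cE] := @lker_form_sub _ _ (symform phi O) (trform phi O).
  by rewrite -[lker _]/(tangent phi O) TE.
have {}cE y : 2 * (phi y O : K) = c * s y.
  have := congr1 (fun f : 'Hom(W, K^o) => f y) cE.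
  rewrite /= trformE [RHS]scale_lfunE -[RHS]/(c * symform phi O y) => E.
  by rewrite [in LHS]E mulrCA symform2.
have c0 : c != 0.
  apply: contra_notN trphiO_neq0 => /eqP c0 y; apply: (mulfI nz2).
  by rewrite cE c0 mul0r mulr0.
(* Solve 2 b(y, O) = c (b(O, y) + b(y, O)) for b(O, y). *)
exists ((2 - c) / c) => y; apply: (mulfI c0).
rewrite mulrA mulrC [c * _]mulrC divfK // mulrBl cE; ring.
Qed.

Lemma Lsigma_eq_Hsigma : Lsigma phi O V = H <-> O_eigen.
Proof.
rewrite LsigmaE Hsigma_lker; split=> [LE|[l lE]].
  have [|c cE] := @lker_form_sub _ _ phiOV sV; first by rewrite LE.
  (* The relation between the restrictions to V extends to W because both b(O, .) and b(., O) vanish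
     at O. *)
  have {}cE y : phi y O = (c - 1) * phi O y.
    have [d ->] := proj_decomp y; rewrite !form_expand phiOO !mulr0 !addr0.
    have := congr1 (fun f : 'Hom(subvs_of V, K^o) => f (p y)) cE.
    rewrite sVE scale_lfunE phiOVE -[_ *: _]/(_ * _) => E.
    by rewrite mulrBl -E mul1r addrAC subrr add0r.
  have c1 : c - 1 != 0.
    by apply: contra_notN trphiO_neq0 => /eqP c1 y; rewrite cE c1 mul0r.
  by exists (c - 1)^-1 => y; rewrite cE mulKf.
have l0 : l != 0.
  have /lfunPn[y] := phiO_neq0; rewrite lE zero_lfunE mulf_eq0.
  by case/norP.
have l1 : l + 1 != 0.
  have [v] := exists_sV; rewrite lE -[X in _ + X]mul1r -mulrDl.
  by apply: contra_eq_neq => ->; rewrite mul0r eq_sym oner_neq0.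
apply/vspaceP => v; rewrite !memv_ker sVE phiOVE lE -[X in _ + X]mul1r -mulrDl.
by rewrite !mulf_eq0 (negPf l0) (negPf l1).
Qed.

(** * The translation of sigma computed on Q(phi) *)

Lemma translation_form_isometry x : phi (T x) (T x) = phi x x.
Proof. by rewrite translation_formE // translation_formE. Qed.

Lemma translation_form_inj x : T x = 0 -> x = 0.
Proof.
move=> Tx; apply/eqP; rewrite -memv0 -phi_inj memv_ker; apply/eqP/lfunP => y.
by rewrite -translation_formE // Tx !form_expand zero_lfunE.
Qed.

Lemma eta_isotropic x : phi (eta phi O x) (eta phi O x) = 0.
Proof. rewrite /eta !form_expand phiOO; ring. Qed.

Lemma proj_eta P : p (eta phi O (vsval P)) = - (s (vsval P) *: P).
Proof. by rewrite /eta lfun_subZ projO proj_id scaler0 sub0r. Qed.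

(* eta inverts the projection from O on Q(phi). *)
Lemma eta_proj u : phi u u = 0 -> eta phi O (vsval (p u)) = - (s u *: u).
Proof.
have [c uE] := proj_decomp u; move: (p u) uE => v -> qu.
have qv : phi (vsval v) (vsval v) = - (c * s (vsval v)).
  rewrite -[LHS]subr0 -qu !form_expand phiOO; ring.
rewrite /eta qv !form_expand phiOO !mulr0 !addr0 scalerDr scaleNr opprD.
by rewrite scalerA addrC mulrC.
Qed.

Lemma eta_scale a x : eta phi O (a *: x) = a ^+ 2 *: eta phi O x.
Proof.
rewrite /eta scalerBr !scalerA !form_expand; congr (_ *: _ - _ *: _); ring.
Qed.

(** Projecting eta(P) from O gives - s(P) P, which recovers the point P' off H. This provides the
    uniqueness clause of [translation_at]. *)
Lemma eta_line (P P' : subvs_of V) : s (vsval P') != 0 -> P' != 0 ->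
  <[eta phi O (vsval P)]>%VS = <[eta phi O (vsval P')]>%VS ->
  <[P]>%VS = <[P']>%VS.
Proof.
move=> sP' P'0 E; apply/esym/eqP; rewrite eqEdim !dim_vline P'0 leq_b1 andbT.
have /vlineP[k] : eta phi O (vsval P') \in <[eta phi O (vsval P)]>%VS.
  by rewrite E memv_line.
move/(congr1 p); rewrite linearZ /= !proj_eta scalerN => /oppr_inj kE.
rewrite -memvE; apply/vlineP; exists ((s (vsval P'))^-1 * (k * s (vsval P))).
by rewrite -!scalerA -kE scalerA mulVf // scale1r.
Qed.

Lemma O_eigen_translation_linear : O_eigen -> translation_linear phi O V.
Proof.
case=> l lE.
have l0 : l != 0.
  have /lfunPn[y] := phiO_neq0; rewrite lE zero_lfunE mulf_eq0.
  by case/norP.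
have TO : T O = l *: O.
  apply/eqP; rewrite -subr_eq0; apply/eqP; apply: (form_nondegr phi_full) => y.
  by rewrite !form_expand translation_formE // lE subrr.
(* T rescales s, so points off H have images off H. *)
have sT x : s (T x) = l^-1 * s x.
  rewrite translation_formE // lE.
  have := lE (T x); rewrite translation_formE // => ->.
  by rewrite mulrDr !mulKf // addrC.
exists (p \o T \o linfun vsval)%VF.
have gE P : (p \o T \o linfun vsval)%VF P = p (T (vsval P)).
  by rewrite comp_lfunE [linfun _ P]lfunE [LHS]comp_lfunE.
split.
  apply: lker_eq0 => P; rewrite gE => pTP.
  have [c] := proj_decomp (T (vsval P)); rewrite pTP add0r => TP.
  (* If T(P) is a multiple of O, so is P, since T fixes the line of O; but P lies in V. *)
  have : T (vsval P - (c / l) *: O) = 0.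
    by rewrite linearB linearZ /= TO TP scalerA divfK // subrr.
  move/translation_form_inj/(congr1 p); rewrite linearB linearZ /= projO scaler0.
  rewrite subr0 proj_id.
  by rewrite linear0.
exists sV; split; first exact: (polyfun_lin sV).
  by have /lfunPn[v] := sV_neq0; rewrite zero_lfunE; exists v.
move=> P; rewrite sVE gE => sP; apply/translation_atP.
set x := eta phi O (vsval P); set P' := p (T (vsval P)).
have P_neq0 : P != 0.
  by apply: contraNneq sP => ->; rewrite -[vsval 0]/(0 : W) !form_expand addr0.
have sP' : s (vsval P') != 0.
  have [c TP] := proj_decomp (T (vsval P)).
  have := sT (vsval P); rewrite TP -/P' !form_expand phiOO !mulr0 !addr0 => ->.
  by rewrite mulf_neq0 // invr_eq0.
have P'_neq0 : P' != 0.
  by apply: contraNneq sP' => ->; rewrite -[vsval 0]/(0 : W) !form_expand addr0.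
have x_neq0 : x != 0.
  apply/negP => /eqP/(congr1 p); rewrite proj_eta linear0 => /eqP.
  by rewrite oppr_eq0 scaler_eq0 (negPf sP) (negPf P_neq0).
have x'_neq0 : eta phi O (vsval P') != 0.
  apply/negP => /eqP/(congr1 p); rewrite proj_eta linear0 => /eqP.
  by rewrite oppr_eq0 scaler_eq0 (negPf sP') (negPf P'_neq0).
have lineE : <[eta phi O (vsval P')]>%VS = <[T x]>%VS.
  apply/eqP; rewrite eqEdim !dim_vline x'_neq0 leq_b1 andbT -memvE.
  have pTx : p (T x) = - (s (vsval P) *: P').
    by rewrite /x /eta lfun_subZ TO scalerA lfun_subZ projO scaler0 sub0r.
  (* [T x] is isotropic and projects to a multiple of P', so eta of that multiple lies on its line;
     the square below comes from eta being quadratic. *)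
  have := @eta_proj (T x); rewrite translation_form_isometry eta_isotropic pTx.
  move/(_ erefl).
  rewrite -scaleNr -[vsval _]/(- s (vsval P) *: vsval P') eta_scale => E.
  have -> : eta phi O (vsval P') = (- s (vsval P)) ^- 2 *: - (s (T x) *: T x).
    by rewrite -E scalerA mulVf ?scale1r // expf_neq0 // oppr_eq0.
  by rewrite memvZ // memvN memvZ // memv_line.
by split=> // P'' _; rewrite -lineE; apply: eta_line.
Qed.

(** H has dimension at least 2, so it contains some Q off the line of [P0]. If q(Q + a P0) vanished
    for a = 0, 1 and -1, then 2 q(P0) would be zero. *)
Lemma exists_second_nonisotropic : (2 < \dim V)%N ->
  exists P1, [/\ P1 \in H, phi (vsval P1) (vsval P1) != 0 & P1 \notin <[P0]>%VS].
Proof.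
move=> dV; have : ~~ (H <= <[P0]>)%VS.
  apply/negP => /dimvS; rewrite dim_vline Hsigma_lker => /leq_trans/(_ (leq_b1 _)).
  by rewrite -ltnS dim_lker_form ?sV_neq0 // dim_subvsV leqNgt dV.
case/subvPn => Q QH QP0; apply: contrapT => noP.
have q0 a : phi (vsval Q + a *: vsval P0) (vsval Q + a *: vsval P0) = 0.
  apply/eqP/negPn/negP => qa; apply: noP; exists (Q + a *: P0); split => //.
    by rewrite memvD // memvZ.
  by apply: contra QP0 => h; rewrite -(addrK (a *: P0) Q) memvB // memvZ // memv_line.
have := q0 0; have := q0 1; have := q0 (-1); rewrite !form_expand.
rewrite !mul0r !mul1r !addr0 => qm qp qq.
move/eqP: qP0; apply; apply: (mulfI nz2).
rewrite mulr0 -[RHS](addr0 0) -{1}qm -{1}qp; move: qq => /=.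
move: (phi (vsval Q) (vsval Q)) => q ->; ring.
Qed.

(* If [g] induces the translation, then g(P) is generically, hence everywhere,
   proportional to pi(T(eta(P))) = q(P) pi(T(O)) - s(P) pi(T(P)). On H this is
   q(P) pi(T(O)); if it were nonzero, g would send all nonisotropic points of H
   to a single point. *)
Lemma translation_linear_O_eigen : [pchar K] =i pred0 -> (2 < \dim V)%N ->
  translation_linear phi O V -> O_eigen.
Proof.
move=> char0 dV [g [kg [f [pf f_neq0 fg]]]].
suff [c TO] : exists c, T O = c *: O.
  by exists c => y; rewrite -translation_formE // TO form_expand.
have [c TO] := proj_decomp (T O); exists c; rewrite [LHS]TO.
set a := p (T O); have [->|a0] := eqVneq a 0; first by rewrite add0r.
have projTeta P : p (T (eta phi O (vsval P))) =
    phi (vsval P) (vsval P) *: a - s (vsval P) *: p (T (vsval P)).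
  by rewrite /eta !lfun_subZ.
(* Proportionality is expressed by 2 by 2 minors: these are polynomial, so their vanishing extends
   from the open set to all P. *)
have proportional (l l' : 'Hom(subvs_of V, K^o)) P :
    l (p (T (eta phi O (vsval P)))) * l' (g P) -
    l' (p (T (eta phi O (vsval P)))) * l (g P) = 0 :> K.
  pose F P : K := l (p (T (eta phi O (vsval P)))) * l' (g P) -
    l' (p (T (eta phi O (vsval P)))) * l (g P).
  rewrite -/(F P); move: P; apply: (polyfun_dense char0 pf) => // [|P fP].
    have polyF (k k' : 'Hom(subvs_of V, K^o)) :
        polyfun (fun P => k (p (T (eta phi O (vsval P)))) * k' (g P) : K).
      have -> : (fun P => k (p (T (eta phi O (vsval P)))) * k' (g P) : K) =
          (fun P => (restr V phi P P * k a +
             (-1) * sV P * (k \o p \o T \o linfun vsval)%VF P) * (k' \o g)%VF P).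
        apply/funext => P; rewrite projTeta lfun_subZ restrE sVE.
        rewrite [(k' \o g)%VF P]comp_lfunE; congr (_ * _).
        rewrite [(_ \o linfun vsval)%VF P]comp_lfunE [linfun _ P]lfunE.
        rewrite [((k \o p) \o _)%VF _]comp_lfunE [(k \o p)%VF _]comp_lfunE /=.
        by rewrite mulN1r mulNr.
      apply: polyfun_mul; last exact: polyfun_lin.
      apply: polyfun_add; apply: polyfun_mul; try exact: polyfun_lin.
      - exact: polyfun_diag.
      - exact: polyfun_const.
      - by apply: polyfun_mul; [exact: polyfun_const | exact: polyfun_lin].
    have -> : F = (fun P => l (p (T (eta phi O (vsval P)))) * l' (g P) +
        (-1) * (l' (p (T (eta phi O (vsval P)))) * l (g P))).
      by apply/funext => P; rewrite mulN1r.
    apply: polyfun_add; first exact: polyF.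
    by apply: polyfun_mul; [exact: polyfun_const | exact: polyF].
  have [_ _ lineE _] := (translation_atP _ _).1 (fg P fP).
  have /vlineP[k kE] : T (eta phi O (vsval P)) \in <[eta phi O (vsval (g P))]>%VS.
    by rewrite lineE memv_line.
  rewrite /F kE linearZ /= proj_eta -scaleNr scalerA !linearZ /=.
  rewrite -![_ *: _]/(_ * _); ring.
have [l la] := form_sep_neq0 a0.
(* With l(a) = 1 and s(P) = 0, the minor for [l] and [l'] is q(P) times the value of [l'] at g(P) -
   l(g(P)) a, up to sign. *)
have gH P : P \in H -> phi (vsval P) (vsval P) != 0 -> g P = l (g P) *: a.
  move=> PH qP; apply/eqP; rewrite -subr_eq0; apply/eqP; apply: form_sep => l'.
  have -> : l' (g P - l (g P) *: a) = l' (g P) - l (g P) * l' a :> K.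
    by rewrite linearB linearZ.
  have := proportional l l' P; rewrite projTeta.
  have /eqP -> : s (vsval P) == 0 by rewrite -mem_Hsigma.
  rewrite scale0r subr0 !linearZ /= la -![_ *: _]/(_ * _) => E.
  by apply: (mulfI qP); rewrite mulr0 -[RHS]E; ring.
have g_inj P : g P = 0 -> P = 0.
  by move=> /eqP; rewrite -memv_ker kg memv0 => /eqP.
have [P1 [P1H qP1 P1P0]] := exists_second_nonisotropic dV.
have lP0 : l (g P0) != 0.
  apply: contraNneq qP0 => l0; have := gH _ P0H qP0; rewrite l0 scale0r.
  by move/g_inj => ->; rewrite -[vsval 0]/(0 : W) form_expand.
have [b0 [b0_neq0 E0]] : exists b, b != 0 /\ g P0 = b *: a.
  by exists (l (g P0)); split; last exact: gH.
have [b1 E1] : exists b, g P1 = b *: a by exists (l (g P1)); apply: gH.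
case/negP: P1P0; apply/vlineP; exists (b1 / b0).
apply/eqP; rewrite -subr_eq0; apply/eqP/g_inj.
by rewrite linearB linearZ /= E0 E1 scalerA divfK // subrr.
Qed.

End Congruence.

Theorem proposition3p5p4 (R : realType) (n : nat) (W : vectType R[i])
    (phi : 'Hom(W, 'Hom(W, R[i]^o))) (O : W) (V : {vspace W}) :
  (3 <= n)%N ->
  \dim {:W} = n.+1 ->
  lker phi = 0%VS -> limg phi = fullv ->
  (3 <= quadric_rank phi)%N ->
  smooth_point phi O ->
  \dim V = n -> O \notin V ->
  [<-> tangent phi O = rperp phi O;
       Lsigma phi O V = Hsigma phi O V;
       translation_linear phi O V].
Proof.
move=> n3 dimW phi_inj phi_full rk O_smooth dimV OV.
have nz2 : (2 : R[i]) != 0 by rewrite pnatr_eq0.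
have dimVW : (\dim V).+1 = \dim {:W} by rewrite dimV dimW.
have dV : (2 < \dim V)%N by rewrite dimV.
have char0 : [pchar R[i]] =i pred0 by exact: pchar_num.
(* The rank assumption enters here, through a point of H off C. *)
have [P0 P0H qP0] := exists_nonisotropic nz2 O_smooth dimVW OV rk.
have E1 : tangent phi O = rperp phi O <-> O_eigen phi O.
  by apply: (tangent_eq_rperp _ _ _ dimVW).
have E2 : Lsigma phi O V = Hsigma phi O V <-> O_eigen phi O.
  exact: (Lsigma_eq_Hsigma _ _ _ _ _ _ P0H qP0).
tfae.
- by move/E1/E2.
- by move/E2; apply: (O_eigen_translation_linear _ _ _ _ _ _ P0H qP0).
- move=> lin; apply/E1; move: lin.
  exact: (translation_linear_O_eigen _ _ _ _ _ _ P0H qP0).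
Qed.
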